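(* Let $k$ be an algebraically closed field and let $Q$ be a finite connected quiver whose underlying non-oriented graph $\Gamma(Q)$ is simply connected (a tree). Let $\rho,\rho'$ be exceptional representations of $Q$ over $k$ with dimension vectors $\alpha,\alpha'$, whose supports are $A,A'\subset V(Q)$ respectively, and suppose that $A\cap A'=\{j\}$ for some vertex $j$. Suppose that $\Gamma(Q)$ does not split at $j$, i.e. the edges adjacent to $j$ can be represented as $x - j - y$. Finally, assume that $\alpha$ is constant on $A\cap\{x,y,j\}$ or $\alpha'$ is constant on $A'\cap\{x,y,j\}$. Then the linear map $F_{\rho,\rho'}$ has maximal rank.
   Context: $V(Q)$, $Arr(Q)$ are the vertices and arrows of $Q$; $s(a),t(a)$ are the origin and end of an arrow $a$. Representations are finite-dimensional. A representation $\rho$ is exceptional if $\mathrm{Hom}(\rho,\rho)=k$ and $\mathrm{Ext}^1(\rho,\rho)=0$. The support of $\alpha\in\mathbb N^{V(Q)}$ is $\{i:\alpha_i\neq 0\}$. For representations $\rho,\rho'$ with dimension vectors $\alpha,\alpha'$, given by linear maps $\rho_a:k^{\alpha_{s(a)}}\to k^{\alpha_{t(a)}}$, $\rho'_a:k^{\alpha'_{s(a)}}\to k^{\alpha'_{t(a)}}$, the map $F_{\rho,\rho'}$ is $$F_{\rho,\rho'}:\prod_{i\in V(Q)}\mathrm{Hom}(k^{\alpha_i},k^{\alpha'_i})\to\prod_{a\in Arr(Q)}\mathrm{Hom}(k^{\alpha_{s(a)}},k^{\alpha'_{t(a)}}),\qquad \{f_i\}_{i}\mapsto\{f_{t(a)}\circ\rho_a-\rho'_a\circ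 f_{s(a)}\}_{a}.$$ A linear map has maximal rank if it is injective or surjective. *)

(* Defs.v *)
From HB Require Import structures.
From mathcomp Require Import all_boot all_order all_algebra.

Set Implicit Arguments.
Unset Strict Implicit.
Unset Printing Implicit Defensive.

Import GRing.Theory.
Local Open Scope ring_scope.

(** * Quivers *)

Record quiver := Quiver {
  vertex : finType;
  arrow : finType;
  src : arrow -> vertex;
  tgt : arrow -> vertex }.

Arguments src {q}.
Arguments tgt {q}.

Section UnderlyingGraph.
Variable Q : quiver.

(* The arrow [a], viewed as an unoriented edge, has endpoints [i] and [j]. *)
Definition joins (a : arrow Q) (i j : vertex Q) : bool :=
  ((src a == i) && (tgt a == j)) || ((src a == j) && (tgt a == i)).

Definition adjacent : rel (vertex Q) := [rel i j | [exists a, joins a i j]].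

Definition connected_quiver : Prop := forall i j, connect adjacent i j.

(* A dart is an edge of the underlying graph with a direction of travel:
   [(a, true)] follows the arrow [a], [(a, false)] goes against it. *)
Definition dart : Type := (arrow Q * bool)%type.
Definition dart_src (d : dart) := if d.2 then src d.1 else tgt d.1.
Definition dart_tgt (d : dart) := if d.2 then tgt d.1 else src d.1.
Definition dart_inv (d : dart) : dart := (d.1, ~~ d.2).

Definition reduced_step : rel dart :=
  [rel d e | (dart_tgt d == dart_src e) && (e != dart_inv d)].

(* The fundamental group of a graph at a base point consists of the closed
   reduced (i.e., backtracking-free) edge walks there, so it is trivial iff no
   nonempty reduced walk [d :: w] is closed.  In particular there are no loops
   and no multiple edges. *)
Definition simply_connected_quiver : Prop :=
  connected_quiver /\
  forall (d : dart) (w : seq dart),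
    path reduced_step d w -> dart_tgt (last d w) != dart_src d.

(* The edges adjacent to [j] are exactly two, forming  x - j - y. *)
Definition not_split_at (x j y : vertex Q) : Prop :=
  exists b c : arrow Q,
    [/\ b != c, joins b x j, joins c j y
      & forall a : arrow Q, (src a == j) || (tgt a == j) = (a \in [:: b; c])].

Definition dim_support (alpha : vertex Q -> nat) : {set vertex Q} :=
  [set i | alpha i != 0%N].

Definition constant_on (alpha : vertex Q -> nat) (B : {set vertex Q}) : Prop :=
  {in B &, forall u v, alpha u = alpha v}.

End UnderlyingGraph.

(** * Representations *)

Section Representations.
Variables (k : fieldType) (Q : quiver).

(* Matrices act on column vectors: [rmap a] is a linear map
   k^(rdim (src a)) -> k^(rdim (tgt a)). *)
Record representation := Representation {
  rdim : vertex Q -> nat;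
  rmap : forall a : arrow Q, 'M[k]_(rdim (tgt a), rdim (src a)) }.

Implicit Types M N E : representation.

Definition vertex_maps M N : Type :=
  {dffun forall i : vertex Q, 'M[k]_(rdim N i, rdim M i)}.

Definition arrow_maps M N : Type :=
  {dffun forall a : arrow Q, 'M[k]_(rdim N (tgt a), rdim M (src a))}.

Definition Fmap M N (f : vertex_maps M N) : arrow_maps M N :=
  [ffun a : arrow Q => (f (tgt a) *m rmap M a - rmap N a *m f (src a))
     : 'M[k]_(rdim N (tgt a), rdim M (src a))].

Definition maximal_rank (X Y : Type) (F : X -> Y) : Prop :=
  injective F \/ (forall y, exists x, F x = y).

Definition is_rep_hom M N (f : vertex_maps M N) : Prop :=
  forall a : arrow Q, f (tgt a) *m rmap M a = rmap N a *m f (src a).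

(* Hom(M, M) = k: c |-> c.id is a bijection from k onto the endomorphisms
   (uniqueness of c forces M to be nonzero). *)
Definition End_is_k M : Prop :=
  forall f : vertex_maps M M, is_rep_hom f ->
    exists! c : k, forall i, f i = c%:M.

Definition short_exact N E M (f : vertex_maps N E) (g : vertex_maps E M) : Prop :=
  [/\ is_rep_hom f, is_rep_hom g & forall i : vertex Q,
    [/\ forall u v : 'cV[k]_(rdim N i), f i *m u = f i *m v -> u = v,
        forall w : 'cV[k]_(rdim M i), exists v : 'cV[k]_(rdim E i), g i *m v = w
      & forall v : 'cV[k]_(rdim E i),
          g i *m v = 0 <-> exists u : 'cV[k]_(rdim N i), f i *m u = v]].

(* Ext^1(M, N) = 0: every extension 0 -> N -> E -> M -> 0 splits. *)
Definition Ext1_vanishes M N : Prop :=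
  forall E (f : vertex_maps N E) (g : vertex_maps E M), short_exact f g ->
    exists h : vertex_maps M E, is_rep_hom h /\ forall i, g i *m h i = 1%:M.

Definition exceptional M : Prop := End_is_k M /\ Ext1_vanishes M M.

End Representations.

(* Main.v *)
Require Import Defs.
From mathcomp Require Import all_boot all_order all_algebra.

(** The two supports meet only at [j], so the source of [Fmap] is essentially
    Hom(k^(alpha j), k^(alpha' j)).  The support of an exceptional
    representation is connected ([support_connected]: otherwise the projection
    onto a component would be a non-scalar endomorphism), hence an arrow from
    A to A' avoiding [j] would close a cycle in the tree
    ([arrow_between_meets]).  Only the two arrows [b], [c] at [j] contribute to
    the target, and with X the component of the argument at [j], an arrow into
    [j] contributes X |-> X rho_b, an arrow out of [j] X |-> - rho'_c X.

    - Both arrows into [j]: the map is X |-> X (rho_b | rho_c), which is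
      injective or surjective as soon as the block row has full rank.
    - Both arrows out of [j]: dually, with the block column of rho'_b, rho'_c.
    - One in and one out: X |-> (X rho_b, - rho'_c X).  If one of the two
      components has a zero target, full rank of the other matrix suffices.
      Otherwise the constancy hypothesis makes rho_b or rho'_c square, hence
      invertible, and the map is injective.

    The full rank statements come from Ext^1(rho, rho) = 0.  Any family [g] of
    matrices on the arrows defines an extension of rho by itself; a splitting
    exhibits [g] as a value of [Fmap] ([Fmap_surjective_of_Ext1]).  Prescribing
    [g] at the two arrows shows that every matrix G of the shape of
    A = (rho_b | rho_c) is of the form X A - A Y.  This forces A to have full
    rank ([full_rank_of_commutators]): if p A = 0 and A q = 0, then p G q = 0
    for every G, so that p = 0 or q = 0. *)

Set Implicit Arguments.
Unset Strict Implicit.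
Unset Printing Implicit Defensive.

Import GRing.Theory.
Local Open Scope ring_scope.

(** * Matrices of full rank *)

Section LinearAlgebra.
Variable k : fieldType.

Definition full_rank m n (A : 'M[k]_(m, n)) := row_free A || row_full A.

(** X A - A Y runs over the tangent space at A to its orbit under changes of
    bases, which is everything only if A has full rank.  Concretely, a row p
    killing A on the left and a column q killed by A satisfy p G q = 0 for
    every G = X A - A Y; a matrix unit G at nonzero entries of p and q
    violates this. *)
Lemma full_rank_of_commutators m n (A : 'M[k]_(m, n)) :
  (forall G : 'M[k]_(m, n), exists X Y, X *m A - A *m Y = G) -> full_rank A.
Proof.
move=> surjA; rewrite /full_rank -kermx_eq0; apply/norP=> -[/rowV0Pn[p pA p0]].
rewrite -col_leq_rank -ltnNge => rkA.
have {}pA : p *m A = 0 by apply/sub_kermxP.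
have [q Aq q0] : exists2 q : 'cV_n, A *m q = 0 & q != 0.
  have : kermx A^T != 0 by rewrite kermx_eq0 /row_free mxrank_tr neq_ltn rkA.
  case/rowV0Pn=> q /sub_kermxP qA q0; exists q^T; last by rewrite trmx_eq0.
  by apply: trmx_inj; rewrite trmx_mul trmxK trmx0.
have /rV0Pn[i pi] := p0; have /cV0Pn[l ql] := q0.
have [X [Y XY]] := surjA ((delta_mx i 0 : 'cV_m) *m (delta_mx 0 l : 'rV_n)).
have : p *m ((delta_mx i 0 : 'cV_m) *m (delta_mx 0 l : 'rV_n)) *m q = 0.
  by rewrite -XY mulmxBr mulmxBl !mulmxA pA !mul0mx subr0 -!mulmxA Aq !mulmx0.
rewrite mulmxA -colE -mulmxA -rowE => /matrixP/(_ 0 0)/eqP.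
by rewrite !mxE big_ord1 !mxE mulf_eq0 (negPf pi) (negPf ql).
Qed.

Lemma full_rank_square m n (A : 'M[k]_(m, n)) :
  m = n -> full_rank A -> row_free A /\ row_full A.
Proof.
move=> mn; case: n / mn A => A.
by rewrite /full_rank /row_full orbb => fA; split.
Qed.

Lemma mx_eq_of_dim0 m n (A B : 'M[k]_(m, n)) : m = 0%N \/ n = 0%N -> A = B.
Proof.
by case=> d0; [move: A B; rewrite d0 => A B; rewrite !flatmx0
               |move: A B; rewrite d0 => A B; rewrite !thinmx0].
Qed.

End LinearAlgebra.

(** * Connected vertex sets in a tree *)

Section Trees.
Variable Q : quiver.
Hypothesis hQ : simply_connected_quiver Q.

(** A vertex path without repetition lifts to a walk without backtracking, since
    following an edge and coming back would repeat a vertex.  The starting dart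
    [d] serves both as the state of the induction and as the extra edge that
    closes a path into a cycle. *)
Lemma lift_reduced_walk (p : seq (vertex Q)) (d : dart Q) :
    path (@adjacent Q) (dart_tgt d) p -> uniq (dart_tgt d :: p) ->
    ohead p != Some (dart_src d) ->
  exists2 w, path (@reduced_step Q) d w & map (@dart_tgt Q) w = p.
Proof.
elim: p d => [|z p IHp] d; first by exists [::].
move=> /= /andP[/existsP[a dz] zp] /andP[d_zp uzp] z_d.
have [e eS eT] : exists2 e : dart Q, dart_src e = dart_tgt d & dart_tgt e = z.
  by case/orP: dz => /andP[/eqP ? /eqP ?]; [exists (a, true)|exists (a, false)].
have [|||w ew wp] := IHp e; rewrite ?eT //.
  apply: contraNneq d_zp; case: p {IHp zp uzp} => // z' p [->].
  by rewrite eS !inE eqxx orbT.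
exists (e :: w); last by rewrite map_cons eT wp.
apply/andP; split=> //; apply/andP; split; first by rewrite eS.
apply: contraNneq z_d => ei; rewrite -eT ei.
by case: (d) => ? [].
Qed.

Lemma no_loop (a : arrow Q) : src a != tgt a.
Proof. by have := hQ.2 (a, false) [::] isT. Qed.

(** Connectivity inside the subgraph induced by [A]. *)
Definition connect_in (A : {set vertex Q}) :=
  connect [rel u v | [&& adjacent u v, u \in A & v \in A]].

Lemma connect_in_uniq_path (A : {set vertex Q}) u v : u \in A ->
  connect_in A u v -> exists p,
    [/\ path (@adjacent Q) u p, uniq (u :: p), {subset u :: p <= A}
       & v = last u p].
Proof.
move=> uA /connectP[p0 /shortenP[p pP up _] ->]; exists p; split=> //.
  by apply: sub_path pP => ? ? /andP[].
elim: p u uA pP {up} => [|z p IHp] u uA /=; first by move=> _ t /[!inE] /eqP->.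
case/andP=> /and3P[_ _ zA] /(IHp _ zA) sub t; rewrite inE => /predU1P[->//|].
exact: sub.
Qed.

(** If the arrow [a] from [A] to [B] avoids [j], a path in [A] from its source to
    [j] followed by a path in [B] from [j] to its target is repetition-free,
    because [A] and [B] share only [j]; it has length at least two, so [a]
    closes it into a reduced cycle. *)
Lemma arrow_between_meets (A B : {set vertex Q}) (j : vertex Q) (a : arrow Q) :
    A :&: B = [set j] ->
    (forall u, u \in A -> connect_in A u j) ->
    (forall v, v \in B -> connect_in B j v) ->
    src a \in A -> tgt a \in B ->
  src a = j \/ tgt a = j.
Proof.
move=> AB cA cB sA tB.
have AB_j t : t \in A -> t \in B -> t = j.
  by move=> tA tB'; apply/set1P; rewrite -AB inE tA.
have jB : j \in B by have := set11 j; rewrite -AB inE => /andP[].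
case: (eqVneq (src a) j) => [|s_j]; first by left.
case: (eqVneq (tgt a) j) => [|t_j]; first by right.
have [p [pP pU pA pj]] := connect_in_uniq_path sA (cA _ sA).
have [q [qP qU qB qt]] := connect_in_uniq_path jB (cB _ tB).
(* The dart (a, false) travels from the target of [a] to its source. *)
have [|||w wP wpq] := @lift_reduced_walk (p ++ q) (a, false).
- by rewrite cat_path pP -pj.
- rewrite -cat_cons cat_uniq pU; move: qU; rewrite cons_uniq.
  case/andP=> jq ->; rewrite andbT.
  apply/hasPn=> t tq; apply: contra jq => tp.
  by rewrite -(AB_j t) ?pA ?qB // inE tq orbT.
- case: p {pP pU} pj pA => [/= /esym/eqP|z p _ pA]; first by rewrite (negPf s_j).
  apply: contraNneq t_j => -[zt]; apply/eqP/AB_j => //.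
  by apply: pA; rewrite !inE zt eqxx orbT.
have := hQ.2 _ _ wP; rewrite -last_map wpq last_cat.
by rewrite [dart_tgt _]/= -pj -qt eqxx.
Qed.

End Trees.

(** * Rigid representations have maps of full rank *)

Section Representations.
Variables (k : fieldType) (Q : quiver).
Implicit Types M N : representation k Q.

(** The cokernel of [Fmap] is Ext^1(M, N): the family [g] is the cocycle of the
    extension with arrow matrices (N_a, g_a; 0, M_a) on N + M, and a section
    (U, 1) commutes with the arrows exactly when [Fmap U = g]. *)
Lemma Fmap_surjective_of_Ext1 M N : Ext1_vanishes M N ->
  forall g : arrow_maps M N, exists f, Fmap f = g.
Proof.
move=> extMN g.
pose E := @Representation k Q (fun i => (rdim N i + rdim M i)%N)
  (fun a => block_mx (rmap N a) (g a) 0 (rmap M a)).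
pose inj : vertex_maps N E :=
  [ffun i => (col_mx 1%:M 0 : 'M_(rdim E i, rdim N i))].
pose prj : vertex_maps E M :=
  [ffun i => (row_mx 0 1%:M : 'M_(rdim M i, rdim E i))].
have [|h [hom_h sec_h]] := extMN E inj prj.
  split=> [a | a | i].
  - rewrite !ffunE /= mul_col_mx mul_block_col mul1mx !mulmx1 !mulmx0 ?mul0mx.
    by rewrite !addr0.
  - rewrite !ffunE /= mul_row_block mul_mx_row !mul0mx !mulmx0 mul1mx mulmx1.
    by rewrite !add0r.
  rewrite !ffunE; split=> [u v | w | v].
  - by rewrite !mul_col_mx !mul1mx => /eq_col_mx[].
  - by exists (col_mx 0 w); rewrite mul_row_col mulmx0 add0r mul1mx.
  rewrite -[v]vsubmxK mul_row_col mul0mx add0r mul1mx.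
  split=> [-> | [u]].
    by exists (usubmx v); rewrite mul_col_mx mul1mx mul0mx.
  by rewrite mul_col_mx mul1mx mul0mx => /eq_col_mx[_ <-].
pose U i : 'M_(rdim N i, rdim M i) := usubmx (h i).
exists [ffun i => U i]; apply/ffunP=> a; rewrite !ffunE.
have hE i : h i = col_mx (U i) 1%:M.
  rewrite -[h i]vsubmxK; congr col_mx; have := sec_h i.
  by rewrite ffunE -{1}[h i]vsubmxK mul_row_col mul0mx add0r mul1mx.
have := hom_h a; rewrite !hE /= mul_col_mx mul_block_col !mulmx1.
by move=> /eq_col_mx[-> _]; rewrite addrC addKr.
Qed.

(** The indicator of the component of [i] in the support is an endomorphism of M,
    hence a scalar; comparing it at [i] and at [j] shows that [j] lies in that
    component. *)
Lemma support_connected M i j : End_is_k M ->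
    i \in dim_support (rdim M) -> j \in dim_support (rdim M) ->
  connect_in (dim_support (rdim M)) i j.
Proof.
set A := dim_support _ => endM iA jA.
pose C t := connect_in A i t.
pose f : vertex_maps M M := [ffun t => ((C t)%:R%:M : 'M_(rdim M t))].
have [|c [fc _]] := endM f.
  move=> a.
  rewrite !ffunE /=.
  have [sA|/[!inE]/negPn/eqP ?] := boolP (src a \in A); last first.
    by apply: mx_eq_of_dim0; right.
  have [tA|/[!inE]/negPn/eqP ?] := boolP (tgt a \in A); last first.
    by apply: mx_eq_of_dim0; left.
  suff -> : C (tgt a) = C (src a) by rewrite scalar_mxC.
  have st : adjacent (src a) (tgt a).
    by apply/existsP; exists a; rewrite /joins !eqxx.
  have ts : adjacent (tgt a) (src a).
    by apply/existsP; exists a; rewrite /joins !eqxx orbT.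
  by apply/idP/idP=> /connect_trans; apply; apply: connect1 => /=;
    apply/and3P.
have Cc t : t \in A -> (C t)%:R = c.
  rewrite inE => t0; have := fc t; rewrite ffunE.
  case: (rdim M t) t0 => // n _ /matrixP/(_ 0 0).
  by rewrite !mxE eqxx !mulr1n.
have := Cc i iA; rewrite -(Cc j jA) /C {1}/connect_in connect0.
by case: connect_in => // /eqP; rewrite oner_eq0.
Qed.

(** The matrix on [a], transported along names [h], [i] for the endpoints of [a]:
    two arrows that share an endpoint only propositionally get block-compatible
    dimensions. *)
Definition arrow_at M N
    (g : forall a : arrow Q, 'M[k]_(rdim N (tgt a), rdim M (src a)))
    a h i (es : src a = h) (et : tgt a = i) : 'M[k]_(rdim N i, rdim M h) :=
  castmx (congr1 (rdim N) et, congr1 (rdim M) es) (g a).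

Lemma arrow_at0 M N (g : arrow_maps M N) a h i
    (es : src a = h) (et : tgt a = i) : g a = 0 -> arrow_at g es et = 0.
Proof.
by case: i / et; case: h / es; rewrite /arrow_at castmx_id.
Qed.

Lemma arrow_at_inj M N (g g' : arrow_maps M N) a h i
    (es : src a = h) (et : tgt a = i) :
  arrow_at g es et = arrow_at g' es et -> g a = g' a.
Proof. by case: i / et; case: h / es; rewrite /arrow_at !castmx_id. Qed.

Lemma arrow_at_Fmap M N (f : vertex_maps M N) a h i
    (es : src a = h) (et : tgt a = i) :
  arrow_at (Fmap f) es et =
  f i *m arrow_at (rmap M) es et - arrow_at (rmap N) es et *m f h.
Proof. by case: i / et; case: h / es; rewrite /arrow_at !castmx_id ffunE. Qed.

Lemma arrow_at_surj M N a h i (es : src a = h) (et : tgt a = i)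
    (G : 'M[k]_(rdim N i, rdim M h)) :
  exists G0, forall g : arrow_maps M N, g a = G0 -> arrow_at g es et = G.
Proof.
by exists (castmx (esym (congr1 (rdim N) et), esym (congr1 (rdim M) es)) G)
  => g; rewrite /arrow_at => ->; rewrite castmxKV.
Qed.

Lemma Fmap_prescribed M N b c hb ib hc ic :
  forall (sb : src b = hb) (tb : tgt b = ib) (sc : src c = hc) (tc : tgt c = ic)
    (Gb : 'M[k]_(rdim N ib, rdim M hb)) (Gc : 'M[k]_(rdim N ic, rdim M hc)),
    Ext1_vanishes M N -> b != c -> exists f : vertex_maps M N,
  arrow_at (Fmap f) sb tb = Gb /\ arrow_at (Fmap f) sc tc = Gc.
Proof.
move=> sb tb sc tc Gb Gc extMN bc.
have [Gb0 Gb0E] := arrow_at_surj sb tb Gb.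
have [Gc0 Gc0E] := arrow_at_surj sc tc Gc.
pose g0 a : 'M[k]_(rdim N (tgt a), rdim M (src a)) := 0.
pose g : arrow_maps M N := [ffun a => dfwith (dfwith g0 Gc0) Gb0 a].
have [f fg] := Fmap_surjective_of_Ext1 extMN g; exists f; rewrite fg.
by rewrite Gb0E ?Gc0E // ffunE ?dfwith_in // dfwith_out ?dfwith_in.
Qed.

Lemma full_rank_arrow M a h i (es : src a = h) (et : tgt a = i) :
  Ext1_vanishes M M -> full_rank (arrow_at (rmap M) es et).
Proof.
move=> extM; apply: full_rank_of_commutators => G.
have [G0 G0E] := arrow_at_surj es et G.
pose g0 a : 'M[k]_(rdim M (tgt a), rdim M (src a)) := 0.
have [f fg] := Fmap_surjective_of_Ext1 extM [ffun a => dfwith g0 G0 a].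
exists (f i), (f h); rewrite -arrow_at_Fmap fg.
by apply: G0E; rewrite ffunE dfwith_in.
Qed.

(** For G = (G_b | G_c), a solution [f] of [Fmap f = G] at [b] and [c] gives
    G = f_j A - A diag(f_x, f_y), where A is the block row. *)
Lemma full_rank_in M b c x y j
    (sb : src b = x) (tb : tgt b = j) (sc : src c = y) (tc : tgt c = j) :
    Ext1_vanishes M M -> b != c ->
  full_rank (row_mx (arrow_at (rmap M) sb tb) (arrow_at (rmap M) sc tc)).
Proof.
move=> extM bc; apply: full_rank_of_commutators => G.
have [f] := Fmap_prescribed sb tb sc tc (lsubmx G) (rsubmx G) extM bc.
rewrite !arrow_at_Fmap => -[fb fc].
exists (f j), (block_mx (f x) 0 0 (f y)).
rewrite mul_mx_row mul_row_block !mulmx0 addr0 add0r opp_row_mx add_row_mx.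
by rewrite fb fc hsubmxK.
Qed.

Lemma full_rank_out M b c x y j
    (sb : src b = j) (tb : tgt b = x) (sc : src c = j) (tc : tgt c = y) :
    Ext1_vanishes M M -> b != c ->
  full_rank (col_mx (arrow_at (rmap M) sb tb) (arrow_at (rmap M) sc tc)).
Proof.
move=> extM bc; apply: full_rank_of_commutators => G.
have [f] := Fmap_prescribed sb tb sc tc (usubmx G) (dsubmx G) extM bc.
rewrite !arrow_at_Fmap => -[fb fc].
exists (block_mx (f x) 0 0 (f y)), (f j).
rewrite mul_block_col mul_col_mx !mul0mx addr0 add0r opp_col_mx add_col_mx.
by rewrite fb fc vsubmxK.
Qed.

(** * Two representations with supports meeting in one vertex *)

Section OneCommonVertex.
Variables (M N : representation k Q) (j : vertex Q).
Hypothesis disj : forall i, i != j -> rdim N i = 0%N \/ rdim M i = 0%N.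

Lemma arrow_at_Fmap_in (f : vertex_maps M N) a h
    (es : src a = h) (et : tgt a = j) : h != j ->
  arrow_at (Fmap f) es et = f j *m arrow_at (rmap M) es et.
Proof.
move=> hj; rewrite arrow_at_Fmap (_ : f h = 0) ?mulmx0 ?subr0 //.
exact: mx_eq_of_dim0 (disj hj).
Qed.

Lemma arrow_at_Fmap_out (f : vertex_maps M N) a i
    (es : src a = j) (et : tgt a = i) : i != j ->
  arrow_at (Fmap f) es et = - (arrow_at (rmap N) es et *m f j).
Proof.
move=> ij; rewrite arrow_at_Fmap (_ : f i = 0) ?mul0mx ?sub0r //.
exact: mx_eq_of_dim0 (disj ij).
Qed.

Lemma vertex_maps_at (X : 'M[k]_(rdim N j, rdim M j)) :
  exists f : vertex_maps M N, f j = X.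
Proof.
pose f0 i : 'M[k]_(rdim N i, rdim M i) := 0.
by exists [ffun i => dfwith f0 X i]; rewrite ffunE dfwith_in.
Qed.

(** Away from [j] the components of a vertex map are empty matrices, so the
    linear map [Fmap] has trivial kernel as soon as its kernel vanishes at
    [j]. *)
Lemma Fmap_injective_at :
    (forall f : vertex_maps M N, (forall a, Fmap f a = 0) -> f j = 0) ->
  injective (@Fmap k Q M N).
Proof.
move=> kerF f1 f2 F12; apply/ffunP=> i.
have [->|ij] := eqVneq i j; last exact: mx_eq_of_dim0 (disj ij).
pose f : vertex_maps M N := [ffun i => f1 i - f2 i].
suff /kerF : forall a, Fmap f a = 0.
  by rewrite ffunE => /eqP; rewrite subr_eq0 => /eqP.
move=> a.
have -> : Fmap f a = Fmap f1 a - Fmap f2 a.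
  by rewrite !ffunE mulmxBl mulmxBr !opprD !opprK addrACA.
by rewrite F12 subrr.
Qed.

Variables b c : arrow Q.
Hypothesis bc : b != c.
Hypothesis others : forall a, a != b -> a != c ->
  rdim N (tgt a) = 0%N \/ rdim M (src a) = 0%N.

Lemma Fmap_surjective_at :
    (forall g : arrow_maps M N,
       exists f : vertex_maps M N, Fmap f b = g b /\ Fmap f c = g c) ->
  forall g, exists f : vertex_maps M N, Fmap f = g.
Proof.
move=> surj g; have [f [fb fc]] := surj g; exists f; apply/ffunP=> a.
have [->//|ab] := eqVneq a b; have [->//|ac] := eqVneq a c.
exact: mx_eq_of_dim0 (others ab ac).
Qed.

Lemma maximal_rank_in_in x y (sb : src b = x) (tb : tgt b = j)
    (sc : src c = y) (tc : tgt c = j) : x != j -> y != j ->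
  Ext1_vanishes M M -> maximal_rank (@Fmap k Q M N).
Proof.
move=> xj yj extM; have [Afree|/row_fullP[L LA]] :=
  orP (full_rank_in sb tb sc tc extM bc).
  left; apply: Fmap_injective_at => f F0; apply: (row_free_inj Afree).
  by rewrite mul0mx mul_mx_row -!arrow_at_Fmap_in // !arrow_at0 ?row_mx0.
right; apply: Fmap_surjective_at => g.
pose G := row_mx (arrow_at g sb tb) (arrow_at g sc tc).
have [f fj] := vertex_maps_at (G *m L); have := mulmx1 G.
rewrite -LA mulmxA -fj mul_mx_row -!arrow_at_Fmap_in // => /eq_row_mx[fb fc].
by exists f; split; [apply: arrow_at_inj fb | apply: arrow_at_inj fc].
Qed.

Lemma maximal_rank_out_out x y (sb : src b = j) (tb : tgt b = x)
    (sc : src c = j) (tc : tgt c = y) : x != j -> y != j ->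
  Ext1_vanishes N N -> maximal_rank (@Fmap k Q M N).
Proof.
move=> xj yj extN; have [/row_freeP[L AL]|Afull] :=
  orP (full_rank_out sb tb sc tc extN bc).
  right; apply: Fmap_surjective_at => g.
  pose G := col_mx (arrow_at g sb tb) (arrow_at g sc tc).
  have [f fj] := vertex_maps_at (- (L *m G)).
  have := mul1mx G.
  rewrite -AL -mulmxA -[L *m G]opprK -fj mulmxN mul_col_mx opp_col_mx.
  rewrite -!arrow_at_Fmap_out // => /eq_col_mx[fb fc].
  by exists f; split; [apply: arrow_at_inj fb | apply: arrow_at_inj fc].
left; apply: Fmap_injective_at => f F0; apply: (row_full_inj Afull).
apply: oppr_inj; rewrite mulmx0 mul_col_mx opp_col_mx -!arrow_at_Fmap_out //.
by rewrite !arrow_at0 ?col_mx0 ?oppr0.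
Qed.

(** The map X |-> (X M_b, - N_c X) can fail to have maximal rank even if both
    matrices have full rank, for instance when M_b and N_c are both nonzero,
    M_b is injective but not surjective and N_c is surjective but not
    injective; the dimension hypotheses exclude this. *)
Lemma maximal_rank_in_out x y (sb : src b = x) (tb : tgt b = j)
    (sc : src c = j) (tc : tgt c = y) : x != j -> y != j ->
    Ext1_vanishes M M -> Ext1_vanishes N N ->
    [\/ rdim M x = 0%N, rdim N y = 0%N, rdim M x = rdim M j |
        rdim N y = rdim N j] ->
  maximal_rank (@Fmap k Q M N).
Proof.
move=> xj yj extM extN.
have Bfull := full_rank_arrow sb tb extM.
have Cfull := full_rank_arrow sc tc extN.
have injB : row_free (arrow_at (rmap M) sb tb) -> injective (@Fmap k Q M N).
  move=> Bfree; apply: Fmap_injective_at => f F0; apply: (row_free_inj Bfree).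
  by rewrite mul0mx -arrow_at_Fmap_in // arrow_at0.
have injC : row_full (arrow_at (rmap N) sc tc) -> injective (@Fmap k Q M N).
  move=> Cfull'; apply: Fmap_injective_at => f F0; apply: (row_full_inj Cfull').
  by apply: oppr_inj; rewrite mulmx0 -arrow_at_Fmap_out // arrow_at0 ?oppr0.
case=> [x0 | y0 | xjM | yjN].
- case/orP: Cfull => [/row_freeP[L CL]|/injC]; last by left.
  right; apply: Fmap_surjective_at => g.
  have [f fj] := vertex_maps_at (- (L *m arrow_at g sc tc)).
  exists f; split; first by apply: mx_eq_of_dim0; right; rewrite sb.
  apply: (@arrow_at_inj _ _ _ _ _ _ _ sc tc).
  by rewrite arrow_at_Fmap_out // fj mulmxN mulmxA CL mul1mx opprK.
- case/orP: Bfull => [/injB|/row_fullP[L LB]]; first by left.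
  right; apply: Fmap_surjective_at => g.
  have [f fj] := vertex_maps_at (arrow_at g sb tb *m L).
  exists f; split; last by apply: mx_eq_of_dim0; left; rewrite tc.
  apply: (@arrow_at_inj _ _ _ _ _ _ _ sb tb).
  by rewrite arrow_at_Fmap_in // fj -mulmxA LB mulmx1.
- by left; apply: injB; case: (full_rank_square (esym xjM) Bfull).
- by left; apply: injC; case: (full_rank_square yjN Cfull).
Qed.

End OneCommonVertex.

End Representations.

Theorem lemma5p6 (k : closedFieldType) (Q : quiver)
  (hQ : simply_connected_quiver Q)
  (rho rho' : representation k Q)
  (hrho : exceptional rho) (hrho' : exceptional rho')
  (j x y : vertex Q)
  (hj : dim_support (rdim rho) :&: dim_support (rdim rho') = [set j])
  (hxy : not_split_at x j y)
  (hconst : constant_on (rdim rho) (dim_support (rdim rho) :&: [set x; y; j]) \/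
            constant_on (rdim rho') (dim_support (rdim rho') :&: [set x; y; j])) :
  maximal_rank (@Fmap k Q rho rho').
Proof.
case: hrho hrho' => endM extM [endN extN].
set A := dim_support _ in hj hconst; set B := dim_support _ in hj hconst.
have [jA jB] : j \in A /\ j \in B.
  by apply/andP; rewrite -in_setI hj set11.
have dimA i : i \notin A -> rdim rho i = 0%N by rewrite inE negbK => /eqP.
have dimB i : i \notin B -> rdim rho' i = 0%N by rewrite inE negbK => /eqP.
have disj i : i != j -> rdim rho' i = 0%N \/ rdim rho i = 0%N.
  rewrite -in_set1 -hj in_setI negb_and => /orP[/dimA|/dimB]; by [right|left].
have cross a : src a != j -> tgt a != j ->
    rdim rho' (tgt a) = 0%N \/ rdim rho (src a) = 0%N.
  move=> sj tj; case: (boolP (src a \in A)) => [sA|/dimA]; last by right.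
  case: (boolP (tgt a \in B)) => [tB|/dimB]; last by left.
  have [u uA|v vB|e|e] := arrow_between_meets hQ hj _ _ sA tB.
  - exact: support_connected.
  - exact: support_connected.
  - by rewrite e eqxx in sj.
  - by rewrite e eqxx in tj.
have [b [c [bc bx cy inc]]] := hxy.
have others a : a != b -> a != c ->
    rdim rho' (tgt a) = 0%N \/ rdim rho (src a) = 0%N.
  move=> ab ac; have := inc a; rewrite !inE (negPf ab) (negPf ac).
  by move/negbT; rewrite negb_or => /andP[sj tj]; apply: cross.
have others' a : a != c -> a != b ->
    rdim rho' (tgt a) = 0%N \/ rdim rho (src a) = 0%N by move=> *; apply: others.
have xj : x != j.
  have := no_loop hQ b; case/orP: bx => /andP[/eqP-> /eqP->] //.
  by rewrite eq_sym.
have yj : y != j.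
  have := no_loop hQ c; case/orP: cy => /andP[/eqP-> /eqP->] //.
  by rewrite eq_sym.
(* In the mixed case the support of rho in {x, y, j} that matters is {u, j} and
   that of rho' is {v, j}, where the arrows run u -> j -> v. *)
have const_dims u v : u \in [set x; y; j] -> v \in [set x; y; j] ->
  [\/ rdim rho u = 0%N, rdim rho' v = 0%N, rdim rho u = rdim rho j |
        rdim rho' v = rdim rho' j].
  move=> uS vS; have jS : j \in [set x; y; j] by rewrite !inE eqxx orbT.
  case: (boolP (u \in A)) => [uA|/dimA]; last by constructor 1.
  case: (boolP (v \in B)) => [vB|/dimB]; last by constructor 2.
  case: hconst => con; [constructor 3|constructor 4];
    by apply: con; rewrite in_setI ?uA ?vB ?jA ?jB.
have xS : x \in [set x; y; j] by rewrite !inE eqxx.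
have yS : y \in [set x; y; j] by rewrite !inE eqxx orbT.
case/orP: bx => /andP[/eqP sb /eqP tb]; case/orP: cy => /andP[/eqP sc /eqP tc].
- exact: (maximal_rank_in_out disj others sb tb sc tc xj yj extM extN
    (const_dims _ _ xS yS)).
- exact: (maximal_rank_in_in disj bc others sb tb sc tc xj yj extM).
- exact: (maximal_rank_out_out disj bc others sb tb sc tc xj yj extN).
- exact: (maximal_rank_in_out disj others' sc tc sb tb yj xj extM extN
    (const_dims _ _ yS xS)).
Qed.
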